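(* There is a set $\mathcal{F}$ of subsets of a set $W$, such that $\mathcal{F}$ has the chordal property and the finite Helly property, and yet there is no tree $T$ with vertex set $W$ such that each member of $\mathcal{F}$ is the vertex set of a subtree of $T$.
   Context: Graphs have no loops or parallel edges, and may be infinite. A tree is a connected graph with no cycles (possibly infinite); a subtree of a tree $T$ is a connected subgraph of $T$. A graph is chordal if all its induced cycles have length three. The intersection graph of a set $\mathcal{F}$ of sets is the graph with vertex set $\mathcal{F}$ in which two distinct members are adjacent if and only if their intersection is nonempty. A set $\mathcal{F}$ of subsets of $W$ has the chordal property if the intersection graph of $\mathcal{F}$ is chordal. It has the finite Helly property if for every finite $k\ge 1$ and all $S_1,\ldots,S_k\in\mathcal{F}$, if $S_i\cap S_j\neq\emptyset$ for all $1\le i<j\le k$, then $S_1\cap\cdots\cap S_k\neq\emptyset$. (In particular, the case $k=1$ says that every member of $\mathcal{F}$ is nonempty.) *)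

(* Defs.v *)
From mathcomp Require Import all_boot.
From mathcomp Require Import classical_sets.

Set Implicit Arguments.
Unset Strict Implicit.
Unset Printing Implicit Defensive.

Local Open Scope classical_set_scope.

(* A simple, possibly infinite, graph whose vertices form a subset of U. *)
Record graph (U : Type) := Graph {
  vset : set U;
  adj : U -> U -> Prop;
  adj_vset : forall x y, adj x y -> vset x /\ vset y;
  adj_sym : forall x y, adj x y -> adj y x;
  adj_irrefl : forall x, ~ adj x x
}.

Definition subgraph (U : Type) (H G : graph U) : Prop :=
  vset H `<=` vset G /\ (forall x y, adj H x y -> adj G x y).

(* p is a path with n edges; a path with no edge is any single point, so
   membership of its end in the graph has to be required separately. *)
Definition is_path (U : Type) (G : graph U) (n : nat) (p : 'I_n.+1 -> U) : Prop :=
  injective p /\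
  (forall i j : 'I_n.+1, nat_of_ord j = i.+1 -> adj G (p i) (p j)).

(* The graph without vertices counts as connected, hence as a tree. *)
Definition connected (U : Type) (G : graph U) : Prop :=
  forall x y, vset G x -> vset G y ->
    exists (n : nat) (p : 'I_n.+1 -> U),
      [/\ is_path G p, p ord0 = x & p ord_max = y].

(* ordS is the cyclic successor i |-> i + 1 mod n on 'I_n. *)
Definition is_cycle (U : Type) (G : graph U) (n : nat) (c : 'I_n -> U) : Prop :=
  [/\ 3 <= n, injective c & forall i, adj G (c i) (c (ordS i))].

Definition is_induced_cycle (U : Type) (G : graph U) (n : nat) (c : 'I_n -> U) :
    Prop :=
  is_cycle G c /\
  (forall i j, adj G (c i) (c j) -> j = ordS i \/ i = ordS j).

Definition chordal (U : Type) (G : graph U) : Prop :=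
  forall (n : nat) (c : 'I_n -> U), is_induced_cycle G c -> n = 3.

Definition tree (U : Type) (T : graph U) : Prop :=
  connected T /\ (forall (n : nat) (c : 'I_n -> U), ~ is_cycle T c).

Definition subtree (U : Type) (H T : graph U) : Prop :=
  subgraph H T /\ connected H.

Section IntersectionGraph.
Variables (W : Type) (F : set (set W)).

Definition inter_adj (A B : set W) : Prop :=
  [/\ F A, F B, A <> B & A `&` B !=set0].

Lemma inter_adj_vset A B : inter_adj A B -> F A /\ F B.
Proof. by case. Qed.

Lemma inter_adj_sym A B : inter_adj A B -> inter_adj B A.
Proof. by case=> FA FB AB AB0; split=> // [/esym//|]; rewrite setIC. Qed.

Lemma inter_adj_irrefl A : ~ inter_adj A A.
Proof. by case. Qed.

Definition intersection_graph : graph (set W) :=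
  Graph inter_adj_vset inter_adj_sym inter_adj_irrefl.

End IntersectionGraph.

Definition chordal_property (W : Type) (F : set (set W)) : Prop :=
  chordal (intersection_graph F).

Definition finite_Helly_property (W : Type) (F : set (set W)) : Prop :=
  forall (k : nat) (S : 'I_k -> set W), 1 <= k -> (forall i, F (S i)) ->
    (forall i j : 'I_k, i < j -> S i `&` S j !=set0) ->
    \bigcap_i S i !=set0.

(* Main.v *)
Require Import Defs.
From mathcomp Require Import all_boot.
From mathcomp Require Import classical_sets.
From mathcomp Require Import all_order all_algebra.

Local Open Scope classical_set_scope.

(** The closed intervals of any linear order have the chordal and the finite
    Helly property. If the order is dense, no tree represents all of them: a
    point a < b has a neighbour x > a inside [a, b] and, picking a < m < x,
    another neighbour y inside [a, m]; a path from y to x inside [y, x]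
    together with a is then a cycle. *)

Definition closed_intervals d (T : orderType d) : set (set T) :=
  fun S => exists a b : T, (a <= b)%O /\ S = [set x | (a <= x <= b)%O].

Lemma val_iter_ordS n (i : 'I_n) k : iter k (@ordS n) i = (k + i) %% n :> nat.
Proof.
elim: k => [|k IHk]; first by rewrite add0n modn_small.
by rewrite iterS /= IHk -addn1 modnDml addn1 addSn.
Qed.

(** The successor acts on ['I_n] as translation by one modulo [n], so a fixed point of its [k]-th
    iterate forces [k] to vanish modulo [n]. *)
Lemma iter_ordS_fix_dvdn n (i : 'I_n) k : iter k (@ordS n) i = i -> n %| k.
Proof.
move=> /(congr1 (@nat_of_ord n)); rewrite val_iter_ordS => e.
have: k + i == 0 + i %[mod n] by rewrite e add0n modn_small.
by rewrite eqn_modDr mod0n.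
Qed.

(** The hypothesis is what an induced cycle yields when the two neighbours of position [i] are
    adjacent. The first case closes up after three steps, so [n] divides 3; the second after one
    step, which [3 <= n] excludes. *)
Lemma ordS_ord_pred_adj n (i : 'I_n) : 3 <= n ->
  ord_pred i = ordS (ordS i) \/ ordS i = ordS (ord_pred i) -> n = 3.
Proof.
move=> n3 [/(congr1 (@ordS n))|]; rewrite ord_predK => /esym e.
  have /(dvdn_leq (ltn0Sn 2)) n3' := iter_ordS_fix_dvdn _ i 3 e.
  by apply/eqP; rewrite eqn_leq n3' n3.
have /(dvdn_leq (ltn0Sn 0)) n1 := iter_ordS_fix_dvdn _ i 1 (esym e).
by have := leq_trans n3 n1.
Qed.

Lemma ordS_neq_ord_pred n (i : 'I_n) : 3 <= n -> ordS i <> ord_pred i.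
Proof.
move=> n3 /(congr1 (@ordS n)); rewrite ord_predK => e.
have /(dvdn_leq (ltn0Sn 1)) n2 := iter_ordS_fix_dvdn _ i 2 e.
by have := leq_trans n3 n2.
Qed.

Lemma closed_intervals_chordal d (T : orderType d) :
  chordal_property (closed_intervals d T).
Proof.
move=> n c [[n3 c_inj c_adj] c_ind].
have n0 : 0 < n by apply: leq_trans n3.
have /fin_all_exists[l /fin_all_exists[r lrP]] : forall i : 'I_n,
    exists a b : T, (a <= b)%O /\ c i = [set x | (a <= x <= b)%O].
  by move=> i; case: (c_adj i).
(* the interval with least right end is simplicial *)
have [i _ i_min] := Order.TotalTheory.arg_minP r (erefl : xpredT (Ordinal n0)).
have r_in j : (c i `&` c j !=set0) -> c j (r i).
  move=> [w]; rewrite (lrP i).2 (lrP j).2 => -[/= /andP[_ wri] /andP[ljw _]].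
  by rewrite (Order.POrderTheory.le_trans ljw wri) /= i_min.
(* Both cycle neighbours of [c i] meet it, hence contain [r i] and meet each other. *)
apply: (ordS_ord_pred_adj _ i n3); apply: c_ind.
have [Fi FSi _ iSi] := c_adj i.
have [Fpi _ _ pii] := c_adj (ord_pred i).
rewrite ord_predK setIC in pii.
split=> //; first by move/c_inj/(ordS_neq_ord_pred _ _ n3).
by exists (r i); split; apply: r_in.
Qed.

(** The greatest left end is a common point: every interval starts no later and, since it meets the
    interval with that left end, ends no earlier. *)
Lemma closed_intervals_Helly d (T : orderType d) :
  finite_Helly_property (closed_intervals d T).
Proof.
move=> k S k0 FS S_meet.
have /fin_all_exists[l /fin_all_exists[r lrP]] : forall i : 'I_k,
    exists a b : T, (a <= b)%O /\ S i = [set x | (a <= x <= b)%O] by [].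
have [i _ i_max] := Order.TotalTheory.arg_maxP l (erefl : xpredT (Ordinal k0)).
exists (l i) => j _; rewrite (lrP j).2 /=; apply/andP; split; first exact: i_max.
have [->|/eqP ij] := eqVneq i j; first exact: (lrP j).1.
have [w [Siw Sjw]] : S i `&` S j !=set0.
  have [/S_meet//|/S_meet|/val_inj//] := ltngtP i j.
  by rewrite setIC.
move: Siw Sjw; rewrite (lrP i).2 (lrP j).2 => /= /andP[liw _] /andP[_ wrj].
exact: Order.POrderTheory.le_trans liw wrj.
Qed.

Lemma connected_neighbour U (H : graph U) (x y : U) :
  connected H -> vset H x -> vset H y -> x <> y -> exists z, adj H x z.
Proof.
move=> cH Hx Hy xy; have [[|n] [p [[_ p_adj] p0 pn]]] := cH x y Hx Hy.
  by case: xy; rewrite -p0 -pn; congr (p _); apply: val_inj.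
by exists (p (lift ord0 ord0)); rewrite -p0; apply: p_adj.
Qed.

(** With at least one edge, every point of the path is an end of an edge: the first point of the
    edge leaving it, any other of the edge entering it. *)
Lemma path_vset U (H : graph U) n (p : 'I_n.+1 -> U) :
  0 < n -> is_path H p -> forall i, vset H (p i).
Proof.
move=> n0 [_ p_adj] i; have [i0|i0] := posnP i.
  have i1 : @inord n 1 = i.+1 :> nat by rewrite inordK ?i0.
  by case: (adj_vset (p_adj i (inord 1) i1)).
have i'n : i.-1 < n.+1 by apply: leq_ltn_trans (leq_pred i) (ltn_ord i).
by case: (adj_vset (p_adj (Ordinal i'n) i (esym (prednK i0)))).
Qed.

(** Otherwise a path in [H] from [x] to [y], closed up through the outside vertex [z], would be a
    cycle of [T]. *)
Lemma two_neighbours_in_subtree U (T H : graph U) (z x y : U) :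
  tree T -> subtree H T -> ~ vset H z -> vset H x -> vset H y ->
  adj T z x -> adj T z y -> x = y.
Proof.
move=> [_ T_acyclic] [[_ HT] cH] Hz Hx Hy zx zy.
have [[|n] [p [pP p0 pn]]] := cH x y Hx Hy.
  by rewrite -p0 -pn; congr (p _); apply: val_inj.
have pH := path_vset _ _ _ _ (ltn0Sn n) pP; case: pP => p_inj p_adj.
(* The cycle has [z] at index 0, followed by the [n.+2] points of the path shifted by one. *)
pose c (i : 'I_n.+3) := if unlift ord0 i is Some j then p j else z.
case: (T_acyclic _ c); split=> // [i j|i]; rewrite /c.
  case: unliftP => [i'|] ->; case: unliftP => [j'|] -> //.
  - by move/p_inj ->.
  - by move=> pz; case: Hz; rewrite -pz.
  - by move=> pz; case: Hz; rewrite pz.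
(* Three kinds of edges: inside the path, from its end [y] back to [z] (where [ordS] wraps around),
   and from [z] to [x]. *)
case: unliftP => [i' ->|->].
  have [i'n|i'n] := ltnP i' n.+1.
    have -> : ordS (lift ord0 i') = lift ord0 (inord i'.+1).
      by apply: val_inj; rewrite /= /bump !add1n inordK ?ltnS // modn_small.
    by rewrite liftK; apply: HT; apply: p_adj; rewrite inordK.
  have {i'n}-> : i' = ord_max.
    by apply: val_inj; apply/eqP; rewrite eqn_leq i'n /= -ltnS ltn_ord.
  have -> : ordS (lift ord0 (@ord_max n.+1)) = ord0.
    by apply: val_inj; rewrite /= /bump !add1n modnn.
  by rewrite unlift_none pn; apply: adj_sym.
have -> : ordS (@ord0 n.+2) = lift ord0 ord0 by apply: val_inj.
by rewrite liftK p0.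
Qed.

Lemma dense_closed_intervals_no_tree d (T : orderType d) (a b : T) :
  (a < b)%O ->
  (forall x y : T, (x < y)%O -> exists z, (x < z < y)%O) ->
  ~ (exists G : graph T,
       [/\ tree G,
           vset G = [set: T]
         & forall S : set T, closed_intervals d T S ->
             exists H : graph T, subtree H G /\ vset H = S]).
Proof.
move=> ab dense [G [tG _ GF]].
(* Such a neighbour is found inside the subtree spanning the interval from [a] to [e]. *)
have neighbour e : (a < e)%O -> exists2 x, adj G a x & (a < x <= e)%O.
  move=> ae; have ae' := Order.POrderTheory.ltW ae.
  have [|H [[[_ HG] cH] vH]] := GF [set x | (a <= x <= e)%O].
    by exists a, e.
  have Ha : vset H a by rewrite vH /= Order.POrderTheory.lexx ae'.
  have He : vset H e by rewrite vH /= Order.POrderTheory.lexx ae'.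
  have ane : a <> e by apply/eqP; rewrite (Order.POrderTheory.lt_eqF ae).
  have [x ax] := connected_neighbour _ H a e cH Ha He ane.
  exists x; first exact: HG.
  have [_] := adj_vset ax; rewrite vH /= => /andP[lax ->].
  rewrite andbT Order.POrderTheory.lt_neqAle lax andbT.
  by apply/eqP => ax_eq; move: ax; rewrite -ax_eq; apply: adj_irrefl.
have [x ax /andP[ltax _]] := neighbour b ab.
have [m /andP[am mx]] := dense a x ltax.
have [y ay /andP[ltay ym]] := neighbour m am.
have yx := Order.POrderTheory.le_lt_trans ym mx.
have yx' := Order.POrderTheory.ltW yx.
have [|H [HG vH]] := GF [set t | (y <= t <= x)%O]; first by exists y, x.
suff e : x = y by move: yx; rewrite e Order.POrderTheory.ltxx.
apply: (two_neighbours_in_subtree _ G H a) ax ay => //; rewrite vH /=.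
- by rewrite (Order.POrderTheory.lt_geF ltay).
- by rewrite yx' Order.POrderTheory.lexx.
- by rewrite yx' Order.POrderTheory.lexx.
Qed.

Theorem mainTheorem2 :
  exists (W : Type) (F : set (set W)),
    [/\ chordal_property F,
        finite_Helly_property F
      & ~ (exists T : graph W,
             [/\ tree T,
                 vset T = [set: W]
               & forall S : set W, F S ->
                   exists H : graph W, subtree H T /\ vset H = S])].
Proof.
(* Any dense linear order with two distinct elements would serve as well as [rat]. *)
exists rat, (closed_intervals _ rat); split.
- exact: closed_intervals_chordal.
- exact: closed_intervals_Helly.
apply: (@dense_closed_intervals_no_tree _ rat 0%R 1%R) => // x y xy.
by exists ((x + y) / 2)%R; rewrite !(Num.Theory.midf_lt xy).
Qed.
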